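(* Let $(x_1^*,\dots,x_n^*,\lambda^* )$ be a KKT point of the problem $$\min_{x_1,\dots,x_n}\ f(x)=\sum_{i=1}^n f_i(x_i)\quad\text{s.t.}\quad \sum_{i=1}^n \mathcal{A}_i(x_i)=b ,$$ and write $x^*=(x_1^*,\dots,x_n^* )$. Then $\tilde x=(\tilde x_1,\dots,\tilde x_n)$ is an optimal solution of the problem if and only if there exists $\alpha>0$ such that $$f(\tilde x)-f(x^* )+\sum_{i=1}^n\big\langle \mathcal{A}_i^\dagger(\lambda^* ),\tilde x_i-x_i^*\big\rangle+\alpha\Big\|\sum_{i=1}^n\mathcal{A}_i(\tilde x_i)-b\Big\|^2=0 .$$
   Context: Here $f_i:\mathbb{R}^{d_i}\to\mathbb{R}\cup\{+\infty\}$ are closed proper convex functions, $\mathcal{A}_i:\mathbb{R}^{d_i}\to\mathbb{R}^m$ are linear mappings with adjoints $\mathcal{A}_i^\dagger$, $b\in\mathbb{R}^m$, $x=(x_1,\dots,x_n)$, and $\|\cdot\|$ is the Euclidean (Frobenius) norm. Standing assumptions: no $\mathcal{A}_i$ is the zero mapping; the solution of $\sum_i\mathcal{A}_i(x_i)=b$ is non-unique; the mapping $(x_1,\dots,x_n)\mapsto\sum_i\mathcal{A}_i(x_i)$ is onto $\mathbb{R}^m$. A KKT point is $(x_1^*,\dots,x_n^*,\lambda^* )$ with $\sum_i\mathcal{A}_i(x_i^* )=b$ and $-\mathcal{A}_i^\dagger(\lambda^* )\in\partial f_i(x_i^* )$ for all $i$, where $\partial f_i$ is the convex subdifferential. *)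

(* Defs.v *)
From HB Require Import structures.
From mathcomp Require Import all_boot all_order all_algebra.
From mathcomp Require Import all_classical all_reals all_analysis.
Import Order.TTheory GRing.Theory Num.Theory.
Import numFieldNormedType.Exports.

Set Implicit Arguments.
Unset Strict Implicit.
Unset Printing Implicit Defensive.

Local Open Scope classical_set_scope.
Local Open Scope ring_scope.

Section EuclideanSpace.
Variable R : realType.

Definition dot (d : nat) (u v : 'rV[R]_d) : R := \sum_(j < d) u 0 j * v 0 j.

(* The norm [`|u|] provided on matrices by the library is the sup norm. *)
Definition enorm (d : nat) (u : 'rV[R]_d) : R := Num.sqrt (dot u u).

(* A linear map [A] acts by [x |-> x *m lin1_mx A], hence the transpose. *)
Definition adjoint (d m : nat) (A : {linear 'rV[R]_d -> 'rV[R]_m})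
    (y : 'rV[R]_m) : 'rV[R]_d :=
  y *m (lin1_mx A)^T.

Lemma dotE d (u v : 'rV[R]_d) : dot u v = (u *m v^T) 0 0.
Proof. by rewrite mxE; apply: eq_bigr => j _; rewrite mxE. Qed.

Lemma dot_adjoint d m (A : {linear 'rV[R]_d -> 'rV[R]_m}) x y :
  dot (A x) y = dot x (adjoint A y).
Proof.
by rewrite !dotE /adjoint trmx_mul trmxK mulmxA mul_rV_lin1.
Qed.

End EuclideanSpace.

Section ConvexFunction.
Variables (R : realType) (d : nat).
Implicit Types f : 'rV[R]_d -> \bar R.

Definition epigraph f : set ('rV[R]_d * R^o) :=
  [set p | (f p.1 <= p.2%:E)%E].

Definition closed_fun f : Prop := closed (epigraph f).

Definition convex_fun f : Prop := convex_set (epigraph f).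

Definition proper_fun f : Prop :=
  (forall x, f x != -oo%E) /\ (exists x, (f x < +oo)%E).

Definition subdifferential f (x : 'rV[R]_d) : set 'rV[R]_d :=
  [set g | forall y, (f x + (dot g (y - x))%:E <= f y)%E].

End ConvexFunction.

Section SeparableProblem.
Variables (R : realType) (n m : nat) (d : 'I_n -> nat).
Variable f : forall i : 'I_n, 'rV[R]_(d i) -> \bar R.
Variable A : forall i : 'I_n, {linear 'rV[R]_(d i) -> 'rV[R]_m}.
Variable b : 'rV[R]_m.
Implicit Types x : forall i : 'I_n, 'rV[R]_(d i).

Definition objective x : \bar R := (\sum_(i < n) f (x i))%E.

Definition constraint_map x : 'rV[R]_m := \sum_(i < n) A i (x i).

Definition feasible x : Prop := constraint_map x = b.

Definition optimal_solution x : Prop :=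
  feasible x /\ forall y, feasible y -> (objective x <= objective y)%E.

Definition KKT_point x (lambda : 'rV[R]_m) : Prop :=
  feasible x /\
  forall i, subdifferential (@f i) (x i) (- adjoint (A i) lambda).

End SeparableProblem.

(* Main.v *)
Require Import Defs.
From HB Require Import structures.
From mathcomp Require Import all_boot all_order all_algebra.
From mathcomp Require Import all_classical all_reals all_analysis.
From mathcomp Require Import lra.
Import Order.TTheory GRing.Theory Num.Theory.
Import numFieldNormedType.Exports.
Local Open Scope classical_set_scope.
Local Open Scope ring_scope.

(** The theorem says that the optimal solutions are the zeros of the Lagrangian
gap at the multiplier [lambda] augmented by a quadratic penalty.  Adding the
subgradient inequalities of a KKT point [xs] over the blocks gives, for every
[y], feasible or not,
  [objective f xs <= objective f y + <lambda, constraint_map A y - b>],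
because the terms [<adjoint (A i) lambda, y i - xs i>] collect into the single
pairing of [lambda] with the constraint residual ([sum_dot_adjoint],
[KKT_objective_le]).

On feasible points the residual vanishes, so this inequality says that [xs] is
optimal, and the optimal solutions are exactly the feasible points with the
objective value of [xs] ([KKT_optimal_solutionP]); the penalized gap is then
zero for any penalty weight.  Conversely the gap and the penalty are both
nonnegative, so if their sum is zero then each is zero: a zero penalty with
positive weight is feasibility, and a zero gap at a feasible point is equality
of objective values.  Extended values do no harm because [objective f xs] is
finite: each [f i] is proper and has a subgradient at [xs i]
([subdifferential_fin_num]). *)

(** * Euclidean pairing *)

Lemma dotC (R : realType) d (u v : 'rV[R]_d) : dot u v = dot v u.
Proof. by apply: eq_bigr => j _; rewrite mulrC. Qed.

Lemma dotNl (R : realType) d (u v : 'rV[R]_d) : dot (- u) v = - dot u v.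
Proof. by rewrite !dotE mulNmx mxE. Qed.

Lemma dot0l (R : realType) d (v : 'rV[R]_d) : dot 0 v = 0.
Proof. by rewrite dotE mul0mx mxE. Qed.

Lemma dot_suml (R : realType) d n (u : 'I_n -> 'rV[R]_d) (v : 'rV[R]_d) :
  dot (\sum_(i < n) u i) v = \sum_(i < n) dot (u i) v.
Proof.
by rewrite dotE mulmx_suml summxE; apply: eq_bigr => i _; rewrite dotE.
Qed.

Lemma enorm_eq0 (R : realType) d (u : 'rV[R]_d) : enorm u = 0 -> u = 0.
Proof.
have sq_ge0 j : true -> 0 <= u 0 j * u 0 j by rewrite -expr2 sqr_ge0.
move=> /eqP; rewrite /enorm sqrtr_eq0 => dot_le0.
have : dot u u == 0 by rewrite eq_le dot_le0 sumr_ge0.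
rewrite psumr_eq0// => /allP u0; apply/rowP => j.
by have := u0 j (mem_index_enum j); rewrite mulf_eq0 orbb mxE => /eqP.
Qed.

(** The adjoints move the blockwise pairings with [lambda] into the constraint
space, where they add up. *)
Lemma sum_dot_adjoint (R : realType) n m (d : 'I_n -> nat)
    (A : forall i : 'I_n, {linear 'rV[R]_(d i) -> 'rV[R]_m})
    (lambda : 'rV[R]_m) (x y : forall i : 'I_n, 'rV[R]_(d i)) :
  \sum_(i < n) dot (adjoint (A i) lambda) (y i - x i) =
  dot (constraint_map A y - constraint_map A x) lambda.
Proof.
rewrite /constraint_map -sumrB dot_suml; apply: eq_bigr => i _.
by rewrite dotC -dot_adjoint linearB.
Qed.

(** * KKT points *)

(** If [f x] were [+oo], the subgradient inequality would force [f] to be [+oo]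
everywhere. *)
Lemma subdifferential_fin_num (R : realType) d (f : 'rV[R]_d -> \bar R) x g :
  proper_fun f -> subdifferential f x g -> (f x \is a fin_num)%E.
Proof.
move=> [f_gtNy [y fy_lty]] /(_ y); rewrite fin_numE f_gtNy /=.
by case: (f x) => //=; rewrite leNgt fy_lty.
Qed.

Section KKT.
Variables (R : realType) (n m : nat) (d : 'I_n -> nat).
Variable f : forall i : 'I_n, 'rV[R]_(d i) -> \bar R.
Variable A : forall i : 'I_n, {linear 'rV[R]_(d i) -> 'rV[R]_m}.
Variables (b : 'rV[R]_m) (xs : forall i : 'I_n, 'rV[R]_(d i)).
Variable lambda : 'rV[R]_m.
Hypothesis f_proper : forall i, proper_fun (f i).
Hypothesis kkt : KKT_point f A b xs lambda.

Set Implicit Arguments.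
Unset Strict Implicit.

Lemma KKT_objective_fin_num : (objective f xs \is a fin_num)%E.
Proof.
rewrite /objective; apply/sum_fin_numP => i _ _.
exact: subdifferential_fin_num (kkt.2 i).
Qed.

(** The right-hand side is the Lagrangian at [(y, lambda)], and the inequality is
the sum over the blocks of the subgradient inequalities at [xs i]. *)
Lemma KKT_objective_le y :
  (objective f xs <= objective f y + (dot (constraint_map A y - b) lambda)%:E)%E.
Proof.
have [xs_feas xs_subdiff] := kkt.
rewrite -leeBlDr// -{1}xs_feas -sum_dot_adjoint -EFinN -sumrN -sumEFin.
rewrite -big_split; apply: lee_sum => i _ /=.
by rewrite -dotNl; exact: xs_subdiff.
Qed.

Lemma KKT_objective_le_feasible y :
  feasible A b y -> (objective f xs <= objective f y)%E.
Proof.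
by move=> y_feas; have := KKT_objective_le y; rewrite y_feas subrr dot0l adde0.
Qed.

Lemma KKT_optimal_solutionP x :
  optimal_solution f A b x <-> feasible A b x /\ objective f x = objective f xs.
Proof.
split=> [[x_feas x_min]|[x_feas x_val]]; split=> //.
  by apply/eqP; rewrite eq_le x_min ?KKT_objective_le_feasible//; exact: kkt.1.
by move=> y; rewrite x_val; exact: KKT_objective_le_feasible.
Qed.

End KKT.

Theorem proposition1 (R : realType) (n m : nat) (d : 'I_n -> nat)
    (f : forall i : 'I_n, 'rV[R]_(d i) -> \bar R)
    (A : forall i : 'I_n, {linear 'rV[R]_(d i) -> 'rV[R]_m})
    (b : 'rV[R]_m)
    (f_closed : forall i, closed_fun (f i))
    (f_proper : forall i, proper_fun (f i))
    (f_convex : forall i, convex_fun (f i))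
    (A_neq0 : forall i, exists u, A i u != 0)
    (sol_nonunique : exists x y : (forall i : 'I_n, 'rV[R]_(d i)),
       [/\ feasible A b x, feasible A b y & x <> y])
    (A_onto : forall c : 'rV[R]_m,
       exists x : (forall i : 'I_n, 'rV[R]_(d i)), constraint_map A x = c)
    (xstar : forall i : 'I_n, 'rV[R]_(d i)) (lambda : 'rV[R]_m)
    (kkt : KKT_point f A b xstar lambda)
    (xtilde : forall i : 'I_n, 'rV[R]_(d i)) :
  optimal_solution f A b xtilde <->
  exists alpha : R, 0 < alpha /\
    (objective f xtilde - objective f xstar
     + (\sum_(i < n) dot (adjoint (A i) lambda) (xtilde i - xstar i))%:E
     + (alpha * enorm (constraint_map A xtilde - b) ^+ 2)%:E = 0)%E.
Proof.
have [xs_feas _] := kkt.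
rewrite sum_dot_adjoint xs_feas (KKT_optimal_solutionP kkt).
have gap_ge0 := KKT_objective_le kkt xtilde.
have objs_fin := KKT_objective_fin_num f_proper kkt.
split=> [[xt_feas ->]|[alpha [alpha_gt0]]].
  exists 1; split=> //.
  rewrite xt_feas subrr dot0l /enorm dot0l sqrtr0 expr0n mulr0 !adde0.
  exact: subee.
(* An infinite objective would make the left-hand side infinite. *)
move: gap_ge0 objs_fin; rewrite /feasible.
case: (objective f xstar) => // vs; case: (objective f xtilde) => // vt.
rewrite -EFinN -!EFinD lee_fin => gap_ge0 _ [] sum0.
have pen_ge0 : 0 <= alpha * enorm (constraint_map A xtilde - b) ^+ 2.
  by rewrite mulr_ge0 ?sqr_ge0 ?ltW.
have pen0 : alpha * enorm (constraint_map A xtilde - b) ^+ 2 = 0 by lra.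
have xt_feas : constraint_map A xtilde = b.
  apply/eqP; rewrite -subr_eq0; apply/eqP/enorm_eq0/eqP.
  by move/eqP: pen0; rewrite mulf_eq0 gt_eqF//= sqrf_eq0.
split=> //; congr EFin.
by move: sum0; rewrite pen0 xt_feas subrr dot0l !addr0 => /subr0_eq.
Qed.
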